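(* Let $A,B\in\Gamma$. Then the equation $X\circ A=Y\circ B$ has a solution in $X,Y\in zk[[z]]$ if and only if $\phi_A\circ\phi_B=\phi_B\circ\phi_A$ for all $\phi_A\in G_A$ and $\phi_B\in G_B$.
   Context: $k$ is an algebraically closed field of characteristic zero and $k[[z]]$ is the ring of formal power series over $k$; $zk[[z]]$ is the set of series with zero constant term, which is a semigroup under composition $\circ$. The order of a series $\sum_{n\ge 0}c_nz^n$ is $\min\{n\ge 0 : c_n\ne 0\}$. $k_1[[z]]$ is the group (under $\circ$) of series of order exactly $1$, and $\Gamma$ is the set of formal power series of order at least $2$. For $A\in\Gamma$, the transition group is $G_A=\{\phi\in k_1[[z]] : A\circ\phi=A\}$.
   Formalization: Solutions X, Y are required to be nonzero: X = Y = 0 lies in zk[[z]] and always solves the equation, so the literal ''only if'' fails (e.g. A = z^2, B = (z+z^2)^2, whose transition groups do not commute). *)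

(* Defs.v *)
From mathcomp Require Import all_boot all_algebra.
Set Implicit Arguments.
Unset Strict Implicit.
Unset Printing Implicit Defensive.
Import GRing.Theory.
Local Open Scope ring_scope.

(* A formal power series \sum_n c_n z^n is its coefficient sequence n |-> c_n;
   equality of series is equality of all coefficients, written =1. *)
Definition fps (k : fieldType) : Type := nat -> k.

Section PowerSeries.
Variable k : fieldType.
Implicit Types f g A : fps k.

Definition fps_one : fps k := fun n => (n == 0%N)%:R.

Definition fps_mul f g : fps k :=
  fun n => \sum_(i < n.+1) f i * g (n - i)%N.

Definition fps_exp f (m : nat) : fps k := iter m (fps_mul f) fps_one.

(* (f o g)(z) = \sum_i f_i g(z)^i.  This is meaningful only when g has zero
   constant term; then g^i has no coefficient below degree i, so the
   coefficient of z^n only involves the indices i <= n. *)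
Definition fps_comp f g : fps k :=
  fun n => \sum_(i < n.+1) f i * fps_exp g i n.

(* The zero series has no order. *)
Definition has_order f (m : nat) : Prop :=
  f m != 0 /\ forall i, (i < m)%N -> f i = 0.

Definition in_zk f : Prop := f 0%N = 0.

(* Solutions of X o A = Y o B are sought among nonzero series: X = Y = 0
   satisfies it for all A and B. *)
Definition nonzero_fps f : Prop := ~ (f =1 (fun=> 0)).

Definition in_k1 f : Prop := has_order f 1.

Definition in_Gamma f : Prop := exists2 m : nat, (2 <= m)%N & has_order f m.

Definition in_transition_group A f : Prop := in_k1 f /\ fps_comp A f =1 A.

End PowerSeries.

(* Main.v *)
(* A series of order n >= 1 in characteristic zero satisfies
   F(phi) - F(psi) = F'(phi) (phi - psi) + ..., so the equation F o phi = F has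
   at most one solution phi with a given linear coefficient, and one for each
   n-th root of unity.  If X o A = Y o B =: F, then G_A and G_B both lie in G_F,
   where phi o psi and psi o phi have the same linear coefficient, hence agree.
   Conversely, let phi in G_A and psi in G_B have primitive roots of unity as
   linear coefficients, of orders n = ord A and m = ord B.  If they commute,
   then F = prod_(i < n) B o phi^i is fixed by both.  A series fixed by phi has
   order divisible by n, so subtracting multiples of powers of A from F forever
   writes F = X o A; in the same way F = Y o B. *)
Require Import Defs.
From mathcomp Require Import all_boot all_algebra.
From mathcomp Require Import separable cyclic cyclotomic ring.
From Stdlib Require Import FunctionalExtensionality Classical.
Set Implicit Arguments.
Unset Strict Implicit.
Unset Printing Implicit Defensive.
Import GRing.Theory.
Local Open Scope ring_scope.

(** * Arithmetic of power series, transferred from polynomials by truncation *)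

Section Series.
Variable k : fieldType.
Implicit Types f g h A B F X phi psi : fps k.

Definition fps_sub f g : fps k := fun n => f n - g n.
Definition fps_var : fps k := fun n => (n == 1%N)%:R.
Definition fps_trunc N f : fps k := fun i => if (i < N)%N then f i else 0.
(** Order at least [N], a condition that the zero series also meets; it serves for differences that
    may turn out to be zero. *)
Definition vanishes_below N f := forall i, (i < N)%N -> f i = 0.

Lemma fpsP f g : f =1 g -> f = g.
Proof. exact: functional_extensionality. Qed.

Lemma fps_mul1 f : fps_mul f (fps_one k) = f.
Proof.
apply: fpsP => n; rewrite /fps_mul big_ord_recr /= subnn mulr1 big1 ?add0r //.
by move=> i _; rewrite /fps_one subn_eq0 leqNgt ltn_ord mulr0.
Qed.

(** A coefficient of a product depends only on truncations of the factors, so the ring laws of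
    [{poly k}] carry over to series. *)
Lemma coef_mul_poly N f g n : (n < N)%N ->
  (\poly_(i < N) f i * \poly_(i < N) g i)`_n = fps_mul f g n.
Proof.
move=> lt_nN; rewrite coefM; apply: eq_bigr => i _; rewrite !coef_poly.
by rewrite (leq_trans (ltn_ord i) lt_nN) (leq_ltn_trans (leq_subr _ _) lt_nN).
Qed.

Lemma fps_mulC f g : fps_mul f g = fps_mul g f.
Proof.
by apply: fpsP => n; rewrite -!(coef_mul_poly _ _ (ltnSn n)) mulrC.
Qed.

Lemma fps_mulA f g h : fps_mul f (fps_mul g h) = fps_mul (fps_mul f g) h.
Proof.
apply: fpsP => n; set p := fun f => \poly_(i < n.+1) f i : {poly k}.
have coef_p f' i : (i < n.+1)%N -> (p f')`_i = f' i.
  by rewrite coef_poly => ->.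
transitivity ((p f * (p g * p h))`_n).
  rewrite coefM; apply: eq_bigr => i _.
  by rewrite coef_p // coef_mul_poly // ltnS leq_subr.
rewrite mulrA coefM; apply: eq_bigr => i _.
by rewrite coef_p ?coef_mul_poly // ltnS leq_subr.
Qed.

Lemma fps_mulBl f g h : fps_mul (fps_sub f g) h = fps_sub (fps_mul f h) (fps_mul g h).
Proof.
by apply: fpsP => n; rewrite /fps_sub /fps_mul -sumrB; apply: eq_bigr => i _; rewrite mulrBl.
Qed.

Lemma fps_mulBr f g h : fps_mul f (fps_sub g h) = fps_sub (fps_mul f g) (fps_mul f h).
Proof. by rewrite fps_mulC fps_mulBl !(fps_mulC f). Qed.

Lemma fps_compBl f g h : fps_comp (fps_sub f g) h = fps_sub (fps_comp f h) (fps_comp g h).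
Proof.
by apply: fpsP => n; rewrite /fps_sub /fps_comp -sumrB; apply: eq_bigr => i _; rewrite mulrBl.
Qed.

(** * Orders and leading coefficients of products, powers and composites *)

Lemma vanishes_mul d e f g : vanishes_below d f -> vanishes_below e g ->
  vanishes_below (d + e) (fps_mul f g) /\ fps_mul f g (d + e)%N = f d * g e.
Proof.
move=> f0 g0; split=> [n lt_n|].
  apply: big1 => i _; case: (ltnP i d) => [/f0->|le_di]; first by rewrite mul0r.
  rewrite g0 ?mulr0 // ltn_subLR; last by rewrite -ltnS.
  by rewrite (leq_trans lt_n) // leq_add2r.
have lt_d: (d < (d + e).+1)%N by rewrite ltnS leq_addr.
rewrite /fps_mul (bigD1 (Ordinal lt_d)) //= addKn big1 ?addr0 // => i ne_i.
have {}ne_i: nat_of_ord i != d by apply: contra ne_i => /eqP def_i; apply/eqP/val_inj.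
case: (ltngtP i d) ne_i => [/f0->|lt_di|//] _; rewrite ?mul0r //.
rewrite g0 ?mulr0 // ltn_subLR ?ltn_add2r //.
by rewrite -ltnS.
Qed.

Lemma vanishes_exp d f i : vanishes_below d f ->
  vanishes_below (i * d) (fps_exp f i) /\ fps_exp f i (i * d)%N = f d ^+ i.
Proof.
move=> f0; elim: i => [|i [IH0 IH]].
  by split=> [n|]; rewrite ?mul0n ?expr0.
by rewrite mulSn exprS -IH; apply: vanishes_mul.
Qed.

Lemma vanishes_comp d e f g : (0 < e)%N -> vanishes_below d f -> vanishes_below e g ->
  vanishes_below (d * e) (fps_comp f g) /\ fps_comp f g (d * e)%N = f d * g e ^+ d.
Proof.
move=> e_gt0 f0 g0; split=> [n lt_n|].
  apply: big1 => i _; case: (ltnP i d) => [/f0->|le_di]; first by rewrite mul0r.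
  rewrite (vanishes_exp i g0).1 ?mulr0 // (leq_trans lt_n) //.
  by rewrite leq_mul2r le_di orbT.
have lt_d: (d < (d * e).+1)%N by rewrite ltnS leq_pmulr.
rewrite /fps_comp (bigD1 (Ordinal lt_d)) //= (vanishes_exp d g0).2.
rewrite big1 ?addr0 // => i ne_i.
have {}ne_i: nat_of_ord i != d by apply: contra ne_i => /eqP def_i; apply/eqP/val_inj.
case: (ltngtP i d) ne_i => [/f0->|lt_di|//] _; rewrite ?mul0r //.
by rewrite (vanishes_exp i g0).1 ?mulr0 // ltn_mul2r e_gt0 lt_di.
Qed.

Lemma in_zk_vanishes f : in_zk f -> vanishes_below 1 f.
Proof. by move=> f0 [|]. Qed.

Lemma fps_exp_lt f i n : in_zk f -> (n < i)%N -> fps_exp f i n = 0.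
Proof.
by move=> /in_zk_vanishes/(vanishes_exp i)[+ _] lt_ni; apply; rewrite muln1.
Qed.

(** * Composition: multiplicativity, associativity, identity *)

Lemma fps_comp0 f g : fps_comp f g 0%N = f 0%N.
Proof. by rewrite /fps_comp big_ord1 mulr1. Qed.

Lemma fps_comp_widen N f g n : in_zk g -> (n < N)%N ->
  fps_comp f g n = \sum_(i < N) f i * fps_exp g i n.
Proof.
move=> g0 lt_nN; rewrite /fps_comp (big_ord_widen N (fun i => f i * fps_exp g i n)) //.
rewrite [RHS](bigID (fun i : 'I_N => (i < n.+1)%N)) /= [X in _ + X]big1 ?addr0 // => i.
by rewrite ltnS -ltnNge => /(fps_exp_lt g0)->; rewrite mulr0.
Qed.

Lemma coef_exp_poly N f m n : (n < N)%N ->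
  ((\poly_(i < N) f i) ^+ m)`_n = fps_exp f m n.
Proof.
elim: m n => [|m IH] n lt_nN; first by rewrite expr0 coef1.
rewrite exprS coefM; apply: eq_bigr => i _.
rewrite coef_poly (leq_trans (ltn_ord i) lt_nN) IH //.
exact: leq_ltn_trans (leq_subr _ _) lt_nN.
Qed.

Lemma coef_comp_poly_widen (p q : {poly k}) N n : (size p <= N)%N ->
  (p \Po q)`_n = \sum_(i < N) p`_i * (q ^+ i)`_n.
Proof.
move=> le_pN; rewrite coef_comp_poly (big_ord_widen N (fun i => p`_i * (q ^+ i)`_n)) //.
rewrite [RHS](bigID (fun i : 'I_N => (i < size p)%N)) /= [X in _ + X]big1 ?addr0 // => i.
by rewrite -leqNgt => le_i; rewrite nth_default ?mul0r.
Qed.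

Lemma fps_comp_mul f g h : in_zk h ->
  fps_comp (fps_mul f g) h = fps_mul (fps_comp f h) (fps_comp g h).
Proof.
move=> h0; apply: fpsP => n; set p := fun f => \poly_(i < n.+1) f i : {poly k}.
have coef_p f' i : (i < n.+1)%N -> (p f')`_i = f' i by rewrite coef_poly => ->.
have comp_p f' i : (i < n.+1)%N -> (p f' \Po p h)`_i = fps_comp f' h i.
  move=> lt_i; rewrite (coef_comp_poly_widen _ _ (size_poly _ _)).
  rewrite (fps_comp_widen _ h0 lt_i); apply: eq_bigr => j _.
  by rewrite coef_p // coef_exp_poly.
transitivity (((p f * p g) \Po p h)`_n); last first.
  rewrite comp_polyM coefM; apply: eq_bigr => i _.
  by rewrite !comp_p // ltnS leq_subr.
(* The size of [p f * p g] may exceed [n.+1], so both sums are brought to the larger bound; the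
   terms with i > n vanish because h^i has no coefficient of degree n < i. *)
rewrite (coef_comp_poly_widen _ _ (leq_maxl _ n.+1)) /fps_comp.
rewrite (big_ord_widen _ (fun i => fps_mul f g i * fps_exp h i n) (leq_maxr (size (p f * p g)) _)).
rewrite [RHS](bigID (fun i : 'I__ => (i < n.+1)%N)) /=.
rewrite [X in _ = _ + X]big1 ?addr0.
  by apply: eq_bigr => i lt_i; rewrite coef_mul_poly // coef_exp_poly.
move=> i; rewrite ltnS -ltnNge => lt_ni.
by rewrite coef_exp_poly // fps_exp_lt // mulr0.
Qed.

Lemma fps_comp1 h : fps_comp (fps_one k) h = fps_one k.
Proof.
apply: fpsP => n; rewrite /fps_comp big_ord_recl /= mul1r big1 ?addr0 //.
by move=> i _; rewrite /fps_one mul0r.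
Qed.

Lemma fps_comp_exp f h m : in_zk h -> fps_comp (fps_exp f m) h = fps_exp (fps_comp f h) m.
Proof.
move=> h0; elim: m => [|m IH]; first exact: fps_comp1.
by rewrite [LHS]fps_comp_mul // IH.
Qed.

Lemma fps_compA f g h : in_zk g -> in_zk h ->
  fps_comp (fps_comp f g) h = fps_comp f (fps_comp g h).
Proof.
move=> g0 h0; apply: fpsP => n; rewrite /fps_comp.
(* Giving the inner sum the bound [n.+1], independent of [i], makes the two sums exchangeable. *)
transitivity (\sum_(i < n.+1) \sum_(j < n.+1) f j * fps_exp g j i * fps_exp h i n).
  apply: eq_bigr => i _; rewrite -mulr_suml; congr (_ * _).
  exact: (fps_comp_widen f g0 (ltn_ord i)).
rewrite exchange_big; apply: eq_bigr => j _ /=.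
rewrite -/(fps_comp g h) -fps_comp_exp // mulr_sumr.
by apply: eq_bigr => i _; rewrite mulrA.
Qed.

Lemma fps_exp_var n m : fps_exp fps_var m n = (n == m)%:R.
Proof.
elim: m n => [|m IH] n //=; rewrite /fps_mul.
case: n => [|n]; first by rewrite big_ord1 mul0r.
rewrite 2!big_ord_recl big1 /= ?addr0 => [|i _]; last by rewrite mul0r.
by rewrite mul0r add0r mul1r subSS subn0 IH eqSS.
Qed.

Lemma fps_comp_var f : fps_comp f fps_var = f.
Proof.
apply: fpsP => n; rewrite /fps_comp big_ord_recr /= fps_exp_var eqxx mulr1.
rewrite big1 ?add0r // => i _.
by rewrite fps_exp_var gtn_eqF ?mulr0.
Qed.

(** * Perturbation of F o phi and uniqueness of solutions *)

Lemma fps_sub_exp phi psi j i : in_zk phi -> in_zk psi -> (1 < j)%N ->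
    vanishes_below j (fps_sub phi psi) ->
  let D := fps_sub (fps_exp phi i.+1) (fps_exp psi i.+1) in
  vanishes_below (j + i) D /\
  D (j + i)%N = i.+1%:R * phi 1%N ^+ i * (phi j - psi j).
Proof.
move=> /in_zk_vanishes phi0 /in_zk_vanishes psi0 j_gt1 eq_j.
have eq1: psi 1%N = phi 1%N by apply/esym/eqP; rewrite -subr_eq0; apply/eqP/eq_j.
elim: i => [|i [IH0 IH]] D.
  rewrite /D /= !fps_mul1 addn0 expr0 !mul1r; split=> //.
(* Telescoping: the first summand contributes one copy of phi_1^(i+1) (phi_j - psi_j) in degree j +
   i + 1, the second contributes i + 1 copies by induction. *)
have DE n: D n = fps_mul (fps_sub phi psi) (fps_exp phi i.+1) n
     + fps_mul psi (fps_sub (fps_exp phi i.+1) (fps_exp psi i.+1)) n.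
  by rewrite fps_mulBl fps_mulBr /fps_sub addrA subrK.
have [phiX0 phiX] := vanishes_exp i.+1 phi0.
rewrite muln1 in phiX0 phiX.
have [v1 c1] := vanishes_mul eq_j phiX0.
have [v2 c2] := vanishes_mul psi0 IH0.
have e: (1 + (j + i) = j + i.+1)%N by rewrite add1n addnS.
rewrite e in v2 c2; split=> [n lt_n|]; first by rewrite DE v1 // v2 // addr0.
rewrite DE c1 c2 phiX IH eq1 /fps_sub exprS [i.+2%:R]mulrSr; ring.
Qed.

(** This is the leading term of F'(phi) (phi - psi). Only the power N + 1 contributes: lower powers
    have coefficient zero in F, and higher ones first differ beyond degree j + N. *)
Lemma fps_comp_perturb F N phi psi j : has_order F N.+1 ->
    in_zk phi -> in_zk psi -> (1 < j)%N -> vanishes_below j (fps_sub phi psi) ->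
  fps_comp F phi (j + N)%N - fps_comp F psi (j + N)%N =
    F N.+1 * (N.+1%:R * phi 1%N ^+ N * (phi j - psi j)).
Proof.
move=> [_ F0] phi0 psi0 j_gt1 eq_j; rewrite /fps_comp -sumrB.
have lt_N: (N.+1 < (j + N).+1)%N by rewrite ltnS -add1n leq_add2r ltnW.
have [_ D_N] := fps_sub_exp N phi0 psi0 j_gt1 eq_j.
rewrite (bigD1 (Ordinal lt_N)) //= -mulrBr -D_N big1 ?addr0 // => i ne_i.
have {}ne_i: nat_of_ord i != N.+1 by apply: contra ne_i => /eqP def_i; apply/eqP/val_inj.
rewrite -mulrBr; case: (ltngtP i N.+1) ne_i => [/F0->|lt_Ni|//] _; rewrite ?mul0r //.
case: (nat_of_ord i) lt_Ni => // i' lt_Ni.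
have [v _] := fps_sub_exp i' phi0 psi0 j_gt1 eq_j.
by rewrite [X in _ * X]v ?mulr0 // ltn_add2l.
Qed.

(** Once the coefficients below j agree, degree j + N of the equation forces phi_j = psi_j, since N
    + 1 is invertible in characteristic zero. *)
Lemma fps_comp_inj F N phi psi : [pchar k] =i pred0 -> has_order F N.+1 ->
    in_k1 phi -> in_zk psi -> phi 1%N = psi 1%N ->
  fps_comp F phi = fps_comp F psi -> phi = psi.
Proof.
move=> char0 oF [phi1 phi0] psi0 eq1 eqF; have zk_phi := phi0 0%N isT.
apply: fpsP; elim/ltn_ind => -[|[|j]] IH //; first by rewrite zk_phi psi0.
have eq_j: vanishes_below j.+2 (fps_sub phi psi).
  by move=> i lt_i; rewrite /fps_sub IH ?subrr.
have := @fps_comp_perturb F N phi psi j.+2 oF zk_phi psi0 isT eq_j.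
rewrite eqF subrr => /esym/eqP; have [FN _] := oF.
rewrite !mulf_eq0 (negPf FN) expf_eq0 (negPf phi1) andbF.
have/pcharf0P-> := char0.
by rewrite subr_eq0 => /eqP.
Qed.

(** * Series built coefficient by coefficient: transition series and left factors *)

Lemma fps_rec (G : nat -> fps k -> k) : exists f, forall j, f j = G j (fps_trunc j f).
Proof.
(* [a j] holds the first [j] coefficients and zeros after them; the desired series is the
   diagonal. *)
pose a := fix a j : fps k :=
  if j is j'.+1 then fun i => if i == j' then G j' (a j') else a j' i else fun=> 0.
have a_ge j : forall i, (j <= i)%N -> a j i = 0.
  elim: j => //= j IH i lt_ji; rewrite gtn_eqF // IH //; exact: ltnW.
have a_lt j : forall i, (i < j)%N -> a j i = a i.+1 i.
  elim: j => // j IH i; rewrite ltnS leq_eqVlt => /predU1P[->//|lt_ij].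
  by rewrite [LHS]/= ltn_eqF // IH.
exists (fun i => a i.+1 i) => j; rewrite /= eqxx; congr (G j _).
apply: fpsP => i; rewrite /fps_trunc; case: ltnP => [/a_lt|/a_ge] -> //.
Qed.

Lemma exists_transition A n (e : k) : [pchar k] =i pred0 -> has_order A n ->
  (0 < n)%N -> e ^+ n = 1 -> exists2 phi, in_transition_group A phi & phi 1%N = e.
Proof.
case: n => // N char0 oA _ eN1.
have e0: e != 0 by apply: contra_eq_neq eN1 => ->; rewrite expr0n eq_sym oner_eq0.
(* By [fps_comp_perturb], [c] is the slope with which phi_j enters the coefficient of degree j + N
   in A o phi; [G] solves that affine equation for phi_j. *)
pose c := A N.+1 * (N.+1%:R * e ^+ N).
have c0: c != 0.
  rewrite !mulf_eq0 (negPf oA.1) expf_eq0 (negPf e0) andbF.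
  by have/pcharf0P-> := char0.
pose G j (g : fps k) := if j == 1%N then e else if j == 0%N then 0 else
   (A (j + N)%N - fps_comp A g (j + N)%N) / c.
have [phi phiE] := fps_rec G.
have phi1 : phi 1%N = e by rewrite phiE.
have phi0 : in_zk phi by rewrite /in_zk phiE.
exists phi => //; split; first by split=> [|[|]] //; rewrite phi1.
have [v cN] := vanishes_comp (ltn0Sn 0) oA.2 (in_zk_vanishes phi0).
rewrite muln1 in v cN.
(* Below degree N + 1 both sides vanish, in degree N + 1 the equation reduces to e^(N+1) = 1, and
   above it the choice of phi_j with j = m - N settles it. *)
move=> m; case: (ltngtP m N.+1) => [lt_m|lt_m|->]; first by rewrite v // oA.2.
  have le_Nm: (N <= m)%N by rewrite (leq_trans (leqnSn N)) // ltnW.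
  pose j := (m - N)%N; have j_gt1: (1 < j)%N by rewrite ltn_subRL addn1.
  have mE: m = (j + N)%N by rewrite subnK.
  have psi0: in_zk (fps_trunc j phi) by rewrite /in_zk /fps_trunc phi0 if_same.
  have eq_j: vanishes_below j (fps_sub phi (fps_trunc j phi)).
    by move=> i lt_i; rewrite /fps_sub /fps_trunc lt_i subrr.
  have := fps_comp_perturb oA phi0 psi0 j_gt1 eq_j.
  rewrite [fps_trunc j phi j]/fps_trunc ltnn subr0 phi1 mulrA -/c phiE {1}/G.
  rewrite !gtn_eqF //; last exact: ltnW.
  by rewrite mulrC divfK // -mE => /addIr.
by rewrite cN phi1 eN1 mulr1.
Qed.

Lemma invariant_factors A n (e : k) phi F : has_order A n -> n.-primitive_root e ->
    in_transition_group A phi -> phi 1%N = e -> fps_comp F phi = F ->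
  exists X, fps_comp X A = F.
Proof.
move=> oA prim_e [[_ phi0] /fpsP Aphi] phi1 Fphi.
have n_gt0 := prim_order_gt0 prim_e.
have zk_phi : in_zk phi by apply: phi0.
have zk_A : in_zk A by apply: oA.2.
(* X_j is chosen to cancel degree j * n of F - X o A, where X_j A^j has leading coefficient X_j
   A_n^j. *)
pose G j (g : fps k) := (F (j * n)%N - fps_comp g A (j * n)%N) / A n ^+ j.
have [X XE] := fps_rec G; exists X.
pose D := fps_sub F (fps_comp X A).
suff D0 m : D m = 0 by apply: fpsP => m; apply/esym/eqP; rewrite -subr_eq0; apply/eqP/D0.
have Dphi: fps_comp D phi = D by rewrite fps_compBl fps_compA // Aphi Fphi.
elim/ltn_ind: m => m IH.
have [/dvdnP[j ->]|not_dvd] := boolP (n %| m)%N.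
  have v: vanishes_below j (fps_sub X (fps_trunc j X)).
    by move=> i lt_i; rewrite /fps_sub /fps_trunc lt_i subrr.
  have [_] := vanishes_comp n_gt0 v oA.2.
  rewrite fps_compBl /fps_sub [fps_trunc j X j]/fps_trunc ltnn subr0 [X j]XE /G.
  rewrite divfK ?expf_neq0 ?oA.1 // => /addIr eqF.
  by rewrite /D /fps_sub eqF subrr.
(* [D] vanishes below [m], so degree m of D o phi = D reads D_m e^m = D_m, and e^m differs from 1
   when n does not divide m. *)
have [_] := vanishes_comp (ltn0Sn 0) IH (in_zk_vanishes zk_phi).
rewrite muln1 Dphi phi1 => /esym/eqP; rewrite -[X in _ == X]mulr1 -subr_eq0 -mulrBr mulf_eq0.
rewrite (subr_eq0 (e ^+ m)) -(prim_order_dvd prim_e) (negPf not_dvd) orbF.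
by move/eqP.
Qed.

(** * The norm of B over the iterates of phi *)

Lemma has_order_mul d e f g : has_order f d -> has_order g e -> has_order (fps_mul f g) (d + e).
Proof.
move=> [fd f0] [ge g0]; have [v c] := vanishes_mul f0 g0.
by split=> //; rewrite c mulf_neq0.
Qed.

Lemma has_order_comp d e f g : (0 < e)%N -> has_order f d -> has_order g e ->
  has_order (fps_comp f g) (d * e).
Proof.
move=> e_gt0 [fd f0] [ge g0]; have [v c] := vanishes_comp e_gt0 f0 g0.
by split=> //; rewrite c mulf_neq0 ?expf_neq0.
Qed.

Lemma has_order_exists f : nonzero_fps f -> exists n, has_order f n.
Proof.
move=> f0; have ex: exists n, f n != 0.
  by apply: NNPP => no; apply: f0 => n; apply/eqP/negPn/negP => fn; apply: no; exists n.
case: (ex_minnP ex) => n fn min_n; exists n; split=> // i lt_in.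
by apply: contraTeq lt_in => /min_n; rewrite -leqNgt.
Qed.

(** The product of B o phi^i over i < n; iterating right composition from B yields B o phi^i. *)
Fixpoint fps_norm phi B n : fps k :=
  if n is n'.+1 then fps_mul (fps_norm phi B n') (iter n' (fun g => fps_comp g phi) B) else fps_one k.

Lemma has_order_norm phi B m n : in_k1 phi -> has_order B m ->
  has_order (fps_norm phi B n) (n * m).
Proof.
move=> k1_phi oB; elim: n => [|n IH]; first by split=> [|//]; rewrite oner_neq0.
rewrite mulSnr; apply: has_order_mul => //; elim: n {IH} => //= n IH.
by rewrite -[m]muln1; apply: has_order_comp.
Qed.

Lemma iter_comp phi B n : in_zk phi ->
  in_zk (iter n (fun g => fps_comp g phi) fps_var) /\
  iter n (fun g => fps_comp g phi) B = fps_comp B (iter n (fun g => fps_comp g phi) fps_var).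
Proof.
move=> phi0; elim: n => [|n [IH0 IH]] /=; first by rewrite fps_comp_var.
by split; [rewrite /in_zk fps_comp0 | rewrite IH fps_compA].
Qed.

(** Both phi^n and z fix A and have linear coefficient 1, so [fps_comp_inj] identifies them. *)
Lemma iter_transition A n phi N : [pchar k] =i pred0 -> has_order A N.+1 ->
    in_transition_group A phi -> phi 1%N ^+ n = 1 ->
  iter n (fun g => fps_comp g phi) fps_var = fps_var.
Proof.
move=> char0 oA [[phi1 phi0] /fpsP Aphi] phin.
have zk_phi : in_zk phi by apply: phi0.
set it := iter n _ _.
have [it0 itA] := iter_comp A n zk_phi.
have it1 : it 1%N = 1.
  rewrite -phin {}/it {itA it0 phin}; elim: n => //= n IH.
  by rewrite /fps_comp !big_ord_recl big_ord0 /= (iter_comp A n zk_phi).1 IH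
     mul0r add0r addr0 /bump /= fps_mul1 exprSr.
symmetry; apply: (fps_comp_inj char0 oA) => //.
  by split=> [|[]]; rewrite ?oner_neq0.
rewrite fps_comp_var -itA {it it0 itA it1 phin}.
by elim: n => //= n <-.
Qed.

Lemma norm_shift phi B n : in_zk phi ->
  fps_norm phi B n.+1 = fps_mul B (fps_comp (fps_norm phi B n) phi).
Proof.
move=> phi0; elim: n => [|n IH]; first by rewrite /= fps_comp1 fps_mulC.
rewrite -[LHS]/(fps_mul (fps_norm phi B n.+1) (iter n.+1 (fun g => fps_comp g phi) B)).
by rewrite [in LHS]IH -fps_mulA -fps_comp_mul.
Qed.

(** Composing with phi permutes the factors cyclically: the last one becomes B o phi^n = B, and
    [norm_shift] puts it in front. *)
Lemma norm_invariant phi B n : in_zk phi -> iter n (fun g => fps_comp g phi) fps_var = fps_var ->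
  fps_comp (fps_norm phi B n) phi = fps_norm phi B n.
Proof.
case: n => [|n] phi0 phin; first exact: fps_comp1.
rewrite [RHS]norm_shift // [fps_norm _ _ _]/= fps_comp_mul // fps_mulC; congr fps_mul.
by rewrite -[LHS]/(iter n.+1 (fun g => fps_comp g phi) B) (iter_comp B n.+1 phi0).2 phin fps_comp_var.
Qed.

(** Each factor is fixed separately: psi moves past phi^i and is absorbed by B. *)
Lemma norm_invariant_commute phi psi B n : in_zk phi -> in_zk psi ->
    fps_comp phi psi = fps_comp psi phi -> fps_comp B psi = B ->
  fps_comp (fps_norm phi B n) psi = fps_norm phi B n.
Proof.
move=> phi0 psi0 comm Bpsi; elim: n => [|n IH] /=; first exact: fps_comp1.
rewrite fps_comp_mul // IH; congr fps_mul; elim: n {IH} => //= n IH.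
by rewrite fps_compA // comm -fps_compA // IH.
Qed.

End Series.

(** * Primitive roots of unity and the equivalence *)

Lemma exists_prim_root (k : closedFieldType) n : [pchar k] =i pred0 -> (0 < n)%N ->
  exists e : k, n.-primitive_root e.
Proof.
move=> char0 n_gt0.
pose p : {poly k} := 'X^n - 1; have [r Dp] := closed_field_poly_normal p.
rewrite (monicP _) ?monicXnsubC // scale1r in Dp.
have r_unity: all n.-unity_root r by apply/allP=> z; rewrite -root_prod_XsubC -Dp.
have sz_r: (n < (size r).+1)%N by rewrite -(size_prod_XsubC r id) -Dp size_XnsubC.
have [|z] := hasP (has_prim_root n_gt0 r_unity _ sz_r); last by exists z.
(* The roots are distinct because X^n - 1 is separable, n being nonzero in [k]. *)
rewrite -separable_prod_XsubC -Dp separable_Xn_sub_1 //.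
by have/pcharf0P-> := char0; rewrite -lt0n.
Qed.

Theorem theorem1p3 (k : closedFieldType) (char0 : [pchar k] =i pred0)
    (A B : fps k) (hA : in_Gamma A) (hB : in_Gamma B) :
  (exists X Y : fps k,
     [/\ in_zk X, in_zk Y, nonzero_fps X, nonzero_fps Y
       & fps_comp X A =1 fps_comp Y B]) <->
  (forall phiA phiB : fps k,
     in_transition_group A phiA -> in_transition_group B phiB ->
     fps_comp phiA phiB =1 fps_comp phiB phiA).
Proof.
case: hA hB => n n_gt1 oA [m m_gt1 oB].
have n_gt0 := ltnW n_gt1; have m_gt0 := ltnW m_gt1.
have zk_A : in_zk A by apply: oA.2.
have zk_B : in_zk B by apply: oB.2.
split=> [[X [Y [X0 Y0 Xn0 _ /fpsP eqXY]]] phi psi|comm].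
  move=> [k1phi /fpsP Aphi] [k1psi /fpsP Bpsi].
  have zk_phi : in_zk phi by apply: k1phi.2.
  have zk_psi : in_zk psi by apply: k1psi.2.
  have [a oX] := has_order_exists Xn0.
  (* X has zero constant term, hence positive order; F = X o A then has the positive order a * n
     that [fps_comp_inj] requires. *)
  have a_gt0 : (0 < a)%N by case: a oX => // -[/eqP]; rewrite X0.
  have oF := has_order_comp n_gt0 oX oA.
  rewrite -(@prednK (a * n)) ?muln_gt0 ?a_gt0 // in oF.
  have lin f g : in_zk f -> in_zk g -> fps_comp f g 1%N = f 1%N * g 1%N.
    move=> /in_zk_vanishes f0 /in_zk_vanishes g0.
    by have [_] := vanishes_comp (ltn0Sn 0) f0 g0; rewrite expr1.
  suff -> : fps_comp phi psi = fps_comp psi phi by [].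
  apply: (fps_comp_inj char0 oF).
  - exact: (has_order_comp (ltn0Sn 0) k1phi k1psi).
  - by rewrite /in_zk fps_comp0.
  - by rewrite !lin // mulrC.
  have FE f : fps_comp A f = A -> in_zk f -> fps_comp (fps_comp X A) f = fps_comp X A.
    by move=> Af f0; rewrite fps_compA // Af.
  have Fphi := FE _ Aphi zk_phi.
  have Fpsi : fps_comp (fps_comp X A) psi = fps_comp X A by rewrite eqXY fps_compA // Bpsi.
  by rewrite -!fps_compA // Fphi Fpsi Fphi.
have [ea prim_ea] := exists_prim_root char0 n_gt0.
have [eb prim_eb] := exists_prim_root char0 m_gt0.
have [phi Gphi phi1] := exists_transition char0 oA n_gt0 (prim_expr_order prim_ea).
have [psi Gpsi psi1] := exists_transition char0 oB m_gt0 (prim_expr_order prim_eb).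
have zk_phi : in_zk phi by apply: Gphi.1.2.
have zk_psi : in_zk psi by apply: Gpsi.1.2.
pose F := fps_norm phi B n.
have oF := has_order_norm n Gphi.1 oB.
have [||X XA] := @invariant_factors k A n ea phi F _ prim_ea Gphi phi1 => //.
  apply: norm_invariant => //.
  move: (oA); rewrite -(prednK n_gt0) => /(iter_transition char0); apply=> //.
  by rewrite phi1 prednK // prim_expr_order.
have [||Y YB] := @invariant_factors k B m eb psi F _ prim_eb Gpsi psi1 => //.
  by apply: norm_invariant_commute => //; apply: fpsP; [apply: comm|apply: Gpsi.2].
have F0 : F 0%N = 0 by apply: oF.2; rewrite muln_gt0 n_gt0.
(* F has an order, so it is not zero, whereas Z = 0 would make Z o C zero. *)
have nz Z C : fps_comp Z C = F -> nonzero_fps Z.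
  move=> ZC /fpsP Z0; case: oF => /eqP + _; apply; rewrite -/F -ZC Z0.
  by apply: big1 => i _; rewrite mul0r.
have EXY : fps_comp X A =1 fps_comp Y B by rewrite XA YB.
exists X, Y; split=> //; [ | |exact: (nz _ _ XA)|exact: (nz _ _ YB)]; rewrite /in_zk.
- by rewrite -(fps_comp0 X A) XA.
- by rewrite -(fps_comp0 Y B) YB.
Qed.
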